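(* Let $E$ be a finite graph without sinks or sources in which every cycle has an exit, let $k\ge1$, and let $\tau\in\mathrm{Perm}(E^k)$ be endpoint-fixing. Let $l\in\mathbb{N}$, $l\ge 1$, and let $\gamma\in E^l$. Let $\{A_1,\dots,A_n\}=\mathcal{L}_1^{-1}(\gamma)\subseteq E_\tau^l$ be the set of (distinct) length-$l$ paths in $E_\tau$ with first label $\gamma$. For each $i$, let $\beta_i=s_\tau(A_i)$, $\alpha_i=r_\tau(A_i)$ and $\delta_i=\mathcal{L}_2(A_i)$. Then $$\lambda_\tau(S_\gamma)=\sum_{i=1}^n S_{\beta_i}S_{\delta_i}S_{\alpha_i}^*.$$
   Context: A graph means a directed multigraph $E=(E^0,E^1,r,s)$. $E^l$ is the set of paths of length $l$ (length-0 paths are vertices), $E^l_{u\to v}$ those with source $u$ and range $v$. A cycle $\mu$ has an exit if some $s(\mu_i)$ emits at least two edges. $C^*(E)$ is the universal $C^*$-algebra generated by mutually orthogonal projections $\{P_v\}_{v\in E^0}$ and partial isometries $\{S_e\}_{e\in E^1}$ with $S_e^*S_e=P_{r(e)}$, $S_e^*S_f=0$ for $e\ne f$, $S_eS_e^*\le P_{s(e)}$, and $P_v=\sum_{s(e)=v}S_eS_e^*$ for $v$ emitting a nonzero finite number of edges. $S_\mu=S_{\mu_1}\cdots S_{\mu_l}$ for a path $\mu$, $S_v=P_v$ for a vertex $v$. $\tau\in\mathrm{Perm}(E^k)$ is endpoint-fixing if $\tau(E^k_{u\to v})=E^k_{u\to v}$ for all $u,v$; then $U_\tau=\sum_{\alpha\in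 E^k}S_{\tau(\alpha)}S_\alpha^*$ is unitary and $\lambda_\tau$ is the unital $*$-endomorphism of $C^*(E)$ with $\lambda_\tau(S_e)=U_\tau S_e$. The permutation graph $(E_\tau,\mathcal{L}_\tau)$ has vertex set $E^{k-1}$, edge set $E^k$, and each $\mu=e\alpha\in E^k$ ($e\in E^1$, $\alpha\in E^{k-1}$) with $\tau(e\alpha)=\beta f$ ($\beta\in E^{k-1}$, $f\in E^1$) is an edge with source $s_\tau(\mu)=\beta$, range $r_\tau(\mu)=\alpha$, first label $\mathcal{L}_1(\mu)=e$ and second label $\mathcal{L}_2(\mu)=f$. $E_\tau^l$ is the set of paths of length $l$ in $E_\tau$; $s_\tau,r_\tau,\mathcal{L}_1,\mathcal{L}_2$ extend to paths in the natural way ($\mathcal{L}_i$ letterwise; the labels of paths in $E_\tau$ are paths in $E$). *)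

(* Defs.v *)
From HB Require Import structures.
From mathcomp Require Import all_boot all_order all_algebra all_fingroup.
From mathcomp Require Import all_classical all_reals topology normedtype.
From mathcomp Require Import complex.

Set Implicit Arguments.
Unset Strict Implicit.
Unset Printing Implicit Defensive.

Import Order.TTheory GRing.Theory Num.Theory.
Import numFieldNormedType.Exports.
Local Open Scope classical_set_scope.
Local Open Scope ring_scope.

(* Unital complex C*-algebras; the scalars [R[i]] are the complex numbers.
   The norm is a field of the mixin because the library's normed modules cannot
   be joined with its algebras: that join would have to sit below
   [numDomainType] in the hierarchy. *)
HB.mixin Record isCStarAlgebra (R : realType) (A : Type)
    of GRing.Algebra R[i] A := {
  star : A -> A;
  starK : involutive star;
  starD : {morph star : x y / x + y};
  starZ : forall (c : R[i]) (x : A), star (c *: x) = c^* *: star x;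
  starM : forall x y : A, star (x * y) = star y * star x;
  cnorm : A -> R;
  cnormD_le : forall x y : A, cnorm (x + y) <= cnorm x + cnorm y;
  cnormZ : forall (c : R[i]) (x : A),
    (cnorm (c *: x))%:C%C = `|c| * (cnorm x)%:C%C;
  cnorm0_eq0 : forall x : A, cnorm x = 0 -> x = 0;
  cnormM_le : forall x y : A, cnorm (x * y) <= cnorm x * cnorm y;
  cnorm_starM : forall x : A, cnorm (star x * x) = cnorm x ^+ 2;
  cnorm_complete : forall u : nat -> A,
    (forall e : R, 0 < e -> exists N, forall m n, (N <= m)%N -> (N <= n)%N ->
       cnorm (u m - u n) < e) ->
    exists x, cnorm (u n - x) @[n --> \oo] --> (0 : R)
}.

#[short(type="cstarAlgType")]
HB.structure Definition CStarAlgebra (R : realType) :=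
  {A of isCStarAlgebra R A & GRing.Algebra R[i] A}.

Section CStarNotions.
Variables (R : realType) (A : cstarAlgType R).

Definition projection (p : A) : Prop := star p = p /\ p * p = p.

Definition partial_isometry (s : A) : Prop := s * star s * s = s.

(* The order of a C*-algebra: [b - a] is positive, i.e. of the form [x^* x]. *)
Definition cstar_le (a b : A) : Prop := exists x : A, b - a = star x * x.

(* Not required to contain the unit of [A]. *)
Record closed_star_subalgebra (D : set A) : Prop := {
  subalg_closed : forall (u : nat -> A) (x : A), (forall n, D (u n)) ->
    cnorm (u n - x) @[n --> \oo] --> (0 : R) -> D x;
  subalg0 : D 0;
  subalgD : forall x y, D x -> D y -> D (x + y);
  subalgZ : forall (c : R[i]) x, D x -> D (c *: x);
  subalgM : forall x y, D x -> D y -> D (x * y);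
  subalg_star : forall x, D x -> D (star x)
}.

End CStarNotions.

(* Not required to be unital. *)
Record star_hom (R : realType) (A B : cstarAlgType R) (f : A -> B) : Prop := {
  star_homD : {morph f : x y / x + y};
  star_homZ : forall (c : R[i]) x, f (c *: x) = c *: f x;
  star_homM : {morph f : x y / x * y};
  star_hom_star : {morph f : x / star x}
}.

Record digraph : Type := Digraph {
  vertex : finType;
  edge : finType;
  src : edge -> vertex;
  rng : edge -> vertex
}.

Fixpoint is_path (E : digraph) (v : vertex E) (s : seq (edge E)) : bool :=
  if s is e :: s' then (src e == v) && is_path (rng e) s' else true.

(* A path of length [l] is stored with its source vertex, so that paths of
   length 0 are vertices. *)
Definition gpath (E : digraph) (l : nat) : Type :=
  {p : vertex E * l.-tuple (edge E) | is_path p.1 p.2}.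
HB.instance Definition _ (E : digraph) (l : nat) := Finite.on (gpath E l).

Definition GPath (E : digraph) l (v : vertex E) (t : l.-tuple (edge E))
    (vt_path : is_path v t) : gpath E l :=
  exist (fun q : vertex E * l.-tuple (edge E) => is_path q.1 q.2)
    (v, t) vt_path.

Section Paths.
Variable E : digraph.

Definition psource l (p : gpath E l) : vertex E := (val p).1.
Definition pedges l (p : gpath E l) : l.-tuple (edge E) := (val p).2.
Definition prange l (p : gpath E l) : vertex E :=
  last (psource p) [seq rng e | e <- pedges p].

Definition no_sinks : Prop := forall v : vertex E, exists e, src e = v.
Definition no_sources : Prop := forall v : vertex E, exists e, rng e = v.

Definition is_cycle l (p : gpath E l) : Prop :=
  (0 < l)%N /\ psource p = prange p.
Definition has_exit l (p : gpath E l) : Prop :=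
  exists2 e, e \in pedges p & (2 <= #|[set f | src f == src e]%SET|)%N.

Definition every_cycle_has_exit : Prop :=
  forall l (p : gpath E l), is_cycle p -> has_exit p.

Lemma is_path_rcons v s (e : edge E) :
  is_path v (rcons s e) =
    is_path v s && (src e == last v [seq rng f | f <- s]).
Proof.
elim: s v => [|f s IHs] v /=; first by rewrite andbT.
by rewrite IHs andbA.
Qed.

Lemma is_pathP l (p : gpath E l) : is_path (psource p) (pedges p).
Proof. exact: (valP p). Qed.

Section NonEmptyPaths.
Variable l : nat.
Implicit Type p : gpath E l.+1.

Definition phead p : edge E := thead (pedges p).
Definition plast p : edge E := last (phead p) (behead (pedges p)).

Lemma pedges_cons p :
  pedges p = phead p :: behead (pedges p) :> seq (edge E).
Proof. by rewrite /phead {1}(tuple_eta (pedges p)). Qed.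

Lemma pedges_rcons p :
  pedges p = rcons (belast (phead p) (behead (pedges p))) (plast p)
    :> seq (edge E).
Proof. by rewrite -lastI pedges_cons. Qed.

Fact pbehead_subproof p :
  is_path (rng (phead p)) [tuple of behead (pedges p)].
Proof.
have : is_path (psource p) (phead p :: behead (pedges p)).
  by rewrite -pedges_cons is_pathP.
by case/andP.
Qed.

(* the [alpha] of [p = e alpha], where [e = phead p] *)
Definition pbehead p : gpath E l := GPath (pbehead_subproof p).

Fact pbelast_subproof p :
  is_path (psource p) [tuple of belast (phead p) (behead (pedges p))].
Proof.
have : is_path (psource p)
    (rcons (belast (phead p) (behead (pedges p))) (plast p)).
  by rewrite -pedges_rcons is_pathP.
by rewrite is_path_rcons => /andP[].
Qed.

(* the [beta] of [p = beta f], where [f = plast p] *)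
Definition pbelast p : gpath E l := GPath (pbelast_subproof p).

Lemma psource_phead p : psource p = src (phead p).
Proof.
have : is_path (psource p) (phead p :: behead (pedges p)).
  by rewrite -pedges_cons is_pathP.
by case/andP => /eqP->.
Qed.

Lemma src_plast p : src (plast p) = prange (pbelast p).
Proof.
have : is_path (psource p)
    (rcons (belast (phead p) (behead (pedges p))) (plast p)).
  by rewrite -pedges_rcons is_pathP.
by rewrite is_path_rcons => /andP[_ /eqP].
Qed.

Lemma prange_plast p : prange p = rng (plast p).
Proof. by rewrite /prange pedges_rcons map_rcons last_rcons. Qed.

Lemma prange_pbehead p : prange (pbehead p) = prange p.
Proof. by rewrite /prange [in RHS]pedges_cons. Qed.

End NonEmptyPaths.

Definition paths_between l (u v : vertex E) : {set gpath E l} :=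
  [set p | (psource p == u) && (prange p == v)].

Definition endpoint_fixing l (tau : {perm gpath E l}) : Prop :=
  forall u v, tau @: paths_between l u v = paths_between l u v.

Lemma endpoint_fixingE l (tau : {perm gpath E l}) (p : gpath E l) :
  endpoint_fixing tau ->
  psource (tau p) = psource p /\ prange (tau p) = prange p.
Proof.
move=> /(_ (psource p) (prange p)) tauE.
have : tau p \in tau @: paths_between l (psource p) (prange p).
  by apply: imset_f; rewrite inE !eqxx.
by rewrite tauE inE => /andP[/eqP-> /eqP->].
Qed.

End Paths.

Section PermutationGraph.
(* [tau] permutes the paths of length [k + 1]: the exponent of the ambient
   [E^k], k >= 1, is written as a successor. *)
Variables (E : digraph) (k : nat) (tau : {perm gpath E k.+1}).

(* [mu = e alpha] with [tau mu = beta f] is an edge from [beta] to [alpha],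
   with first label [e] and second label [f]. *)
Definition perm_graph : digraph :=
  @Digraph (gpath E k) (gpath E k.+1)
    (fun mu => pbelast (tau mu)) (fun mu => pbehead mu).

Definition edge_label1 (mu : edge perm_graph) : edge E := @phead E k mu.
Definition edge_label2 (mu : edge perm_graph) : edge E := @plast E k (tau mu).

(* Source and range of a path of the permutation graph, as paths of [E]. *)
Definition tau_source l (A : gpath perm_graph l) : gpath E k := psource A.
Definition tau_range l (A : gpath perm_graph l) : gpath E k := prange A.

Hypothesis tauP : endpoint_fixing tau.

Fact label1_subproof l (A : gpath perm_graph l) :
  is_path (psource (tau_source A)) (map_tuple edge_label1 (pedges A)).
Proof.
suff labelP (s : seq (gpath E k.+1)) (v : gpath E k) :
    @is_path perm_graph v s -> is_path (psource v) (map edge_label1 s).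
  exact: labelP (is_pathP A).
elim: s v => [|mu s IHs] v //= /andP[/eqP <- /IHs muP].
have [tau_src _] := endpoint_fixingE mu tauP.
rewrite -[psource (pbelast _)]/(psource (tau mu)) tau_src psource_phead eqxx.
exact: muP.
Qed.

Fact label2_subproof l (A : gpath perm_graph l) :
  is_path (prange (tau_source A)) (map_tuple edge_label2 (pedges A)).
Proof.
suff labelP (s : seq (gpath E k.+1)) (v : gpath E k) :
    @is_path perm_graph v s -> is_path (prange v) (map edge_label2 s).
  exact: labelP (is_pathP A).
elim: s v => [|mu s IHs] v //= /andP[/eqP <- /IHs muP].
have [_ tau_rng] := endpoint_fixingE mu tauP.
rewrite src_plast eqxx /=.
by rewrite -prange_plast tau_rng -prange_pbehead.
Qed.

(* The letterwise labels; for [l > 0] their source vertices are forced. *)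
Definition label1 l (A : gpath perm_graph l) : gpath E l :=
  GPath (label1_subproof A).
Definition label2 l (A : gpath perm_graph l) : gpath E l :=
  GPath (label2_subproof A).

End PermutationGraph.

Section GraphAlgebra.
Variables (R : realType) (E : digraph).

Section Family.
Variables (A : cstarAlgType R) (P : vertex E -> A) (S : edge E -> A).

Record cuntz_krieger_family : Prop := {
  ck_proj : forall v, projection (P v);
  ck_orth : forall v w, v != w -> P v * P w = 0;
  ck_pisom : forall e, partial_isometry (S e);
  ck_range : forall e, star (S e) * S e = P (rng e);
  ck_edge_orth : forall e f, e != f -> star (S e) * S f = 0;
  ck_le : forall e, cstar_le (S e * star (S e)) (P (src e));
  ck_sum : forall v, (exists e, src e = v) ->
    P v = \sum_(e | src e == v) S e * star (S e)
}.

Definition S_path l (p : gpath E l) : A :=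
  if l is 0 then P (psource p) else \prod_(e <- pedges p) S e.

Definition U_perm l (tau : {perm gpath E l}) : A :=
  \sum_(a : gpath E l) S_path (tau a) * star (S_path a).

Record is_lambda l (tau : {perm gpath E l}) (lambda : A -> A) : Prop := {
  lambda_hom : star_hom lambda;
  lambda1 : lambda 1 = 1;
  lambda_edge : forall e, lambda (S e) = U_perm tau * S e
}.

End Family.

(* [A], with the family [P], [S], is the graph C*-algebra of [E].  Every
   C*-algebra embeds in a unital one and [star_hom] does not preserve the unit,
   so unital targets [B] suffice; generation by the family, without the unit,
   forces [1 = \sum_v P v] in [A]. *)
Record is_graph_algebra (A : cstarAlgType R) (P : vertex E -> A)
    (S : edge E -> A) : Prop := {
  graph_algebra_ck : cuntz_krieger_family P S;
  graph_algebra_gen : forall D : set A, closed_star_subalgebra D ->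
    (forall v, D (P v)) -> (forall e, D (S e)) -> forall x, D x;
  graph_algebra_univ : forall (B : cstarAlgType R) (Q : vertex E -> B)
      (T : edge E -> B), cuntz_krieger_family Q T ->
    exists f : A -> B, [/\ star_hom f, forall v, f (P v) = Q v
                                     & forall e, f (S e) = T e]
}.

End GraphAlgebra.

(* Main.v *)
Require Import Defs.
From mathcomp Require Import all_boot all_order all_algebra all_fingroup.
From mathcomp Require Import all_classical all_reals topology normedtype.
From mathcomp Require Import complex.

Import GRing.Theory.
Local Open Scope ring_scope.

(** Write [T mu = S_beta S_f S_alpha^*] for an edge [mu = e alpha] of the
    permutation graph, where [tau mu = beta f].  In [U_tau S_e], the
    Cuntz-Krieger relations kill every summand [S_(tau mu) S_mu^* S_e] whose
    [mu] does not start with [e], and turn the remaining ones into [T mu]; hence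
    [lambda(S_e)] is the sum of the [T mu] over the edges with first label [e]
    ([U_perm_edge]).  Multiplying such sums for the successive edges of
    [gamma] gives a sum of products of [T]'s over words in the edges of the
    permutation graph.  Since the [S_alpha], for [alpha] of a fixed length, have
    orthogonal ranges ([star_S_path_mul]), a product [T mu T nu] vanishes unless
    the range of [mu] is the source of [nu], in which case the inner factor
    [S_alpha^* S_beta] is a vertex projection that is absorbed by its neighbours
    ([edge_term_mul]).  So exactly the words that are paths survive, and each
    contributes the summand of the statement.

    The induction on the length of [gamma] prepends one edge at a time
    ([sum_edge_path_term]).  Its base case is length 1, where [gamma] is an edge
    [e] followed by the vertex [r(e)].  To treat it by the same lemma, the sum
    for that vertex is shown to be a right unit for the summands of [lambda(S_e)]
    ([edge_term_unit]); this avoids computing [lambda(P_v)]. *)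

(** * Paths as a first edge followed by a path *)

Section PathCons.
Set Implicit Arguments.
Unset Strict Implicit.
Context {E : digraph}.

Lemma gpath_inj l (p q : gpath E l) :
  psource p = psource q -> pedges p = pedges q :> seq (edge E) -> p = q.
Proof.
move=> eq_src eq_edges; apply: val_inj.
rewrite [val p]surjective_pairing [val q]surjective_pairing; congr (_, _).
  exact: eq_src.
by apply: val_inj; exact: eq_edges.
Qed.

Lemma gpath_cons_inj l (p q : gpath E l.+1) :
  phead p = phead q -> pbehead p = pbehead q -> p = q.
Proof.
move=> eq_head eq_behead; apply: gpath_inj.
  by rewrite !psource_phead eq_head.
rewrite [LHS]pedges_cons [RHS]pedges_cons eq_head.
by have /(congr1 val) := congr1 (@pedges E l) eq_behead => /= ->.
Qed.

Lemma gpath_cons_eq l (p q : gpath E l.+1) :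
  (p == q) = (phead p == phead q) && (pbehead p == pbehead q).
Proof.
apply/eqP/andP => [->|[/eqP eq_head /eqP eq_behead]]; first by rewrite !eqxx.
exact: gpath_cons_inj.
Qed.

Lemma gpath_cons_ex l (e : edge E) (p : gpath E l) :
  psource p = rng e -> exists2 q : gpath E l.+1, phead q = e & pbehead q = p.
Proof.
move=> src_p.
have ep_path : is_path (src e) [tuple of e :: pedges p].
  by rewrite /= eqxx -src_p is_pathP.
have head_q : phead (GPath ep_path) = e by [].
exists (GPath ep_path) => //.
by apply: gpath_inj => //; rewrite src_p.
Qed.

Lemma gpath0_eq (p q : gpath E 0) : (p == q) = (psource p == psource q).
Proof.
apply/eqP/eqP => [-> //|eq_src]; apply: gpath_inj => //.
by rewrite (tuple0 (pedges p)) (tuple0 (pedges q)).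
Qed.

Lemma prange0 (p : gpath E 0) : prange p = psource p.
Proof. by rewrite /prange (tuple0 (pedges p)). Qed.

Lemma gpath0_ex (v : vertex E) : exists p : gpath E 0, psource p = v.
Proof. by exists (@GPath E 0 v [tuple] isT). Qed.

(** The condition on the right says which pairs of an edge and a path compose;
    on the terms of a product indexed by such pairs it is imposed by
    orthogonality. *)
Lemma sum_gpath_cons (V : nmodType) l (Q : edge E -> gpath E l -> bool)
    (F : edge E -> gpath E l -> V) :
  \sum_(p : gpath E l.+1 | Q (phead p) (pbehead p)) F (phead p) (pbehead p) =
  \sum_(e : edge E) \sum_(p : gpath E l | (psource p == rng e) && Q e p) F e p.
Proof.
rewrite pair_big_dep /=.
pose h (q : gpath E l.+1) := (phead q, pbehead q).
have h_inj : injective h.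
  move=> p q eq_pq; apply: gpath_cons_inj.
    exact: (congr1 (fun x => x.1) eq_pq).
  exact: (congr1 (fun x => x.2) eq_pq).
rewrite (eq_bigl (mem (h @: [set q | Q (phead q) (pbehead q)]%SET))); last first.
  move=> [e p] /=; apply/andP/imsetP => [[/eqP src_p Qep]|[q]].
    have [q eq_head eq_behead] := gpath_cons_ex src_p.
    by exists q; rewrite ?inE /h ?eq_head ?eq_behead.
  by rewrite inE => Qq [-> ->].
rewrite big_imset /=; last by move=> p q _ _ /h_inj.
by apply: eq_bigl => q; rewrite inE.
Qed.

End PathCons.

(** * Partial isometries of paths *)

Section CuntzKrieger.
Set Implicit Arguments.
Unset Strict Implicit.
Context {R : realType} {E : digraph} {A : cstarAlgType R}.
Context {P : vertex E -> A} {S : edge E -> A}.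
Hypothesis ck : cuntz_krieger_family P S.

Local Notation Sp := (S_path P S).

Lemma ck_star_mul e f : star (S e) * S f = if e == f then P (rng e) else 0.
Proof.
case: eqP => [<-|/eqP neq_ef]; first exact: (ck_range ck).
exact: (ck_edge_orth ck).
Qed.

Lemma ck_P_mul v w : P v * P w = if v == w then P v else 0.
Proof.
case: eqP => [<-|/eqP]; last exact: (ck_orth ck).
by have [] := ck_proj ck v.
Qed.

Lemma ck_edge_range e : S e * P (rng e) = S e.
Proof. by rewrite -(ck_range ck) mulrA; exact: (ck_pisom ck). Qed.

(** The Cuntz-Krieger sum at [src e] contains the range projection of [S e],
    and its other terms are orthogonal to [S e]. *)
Lemma ck_src_edge e : P (src e) * S e = S e.
Proof.
rewrite (ck_sum ck); last by exists e.
rewrite mulr_suml (bigD1 e) //= big1 ?addr0; first exact: (ck_pisom ck).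
move=> f /andP[_ neq_fe]; rewrite -mulrA ck_star_mul.
by rewrite (negPf neq_fe) mulr0.
Qed.

(** The prefix [P (psource p)] makes the formula uniform in the length. *)
Lemma S_pathE l (p : gpath E l) :
  Sp p = P (psource p) * \prod_(e <- pedges p) S e.
Proof.
case: l p => [|l] p /=.
  by rewrite (tuple0 (pedges p)) big_nil mulr1.
by rewrite pedges_cons big_cons mulrA psource_phead ck_src_edge.
Qed.

Lemma src_S_path l (p : gpath E l) : P (psource p) * Sp p = Sp p.
Proof. by rewrite S_pathE mulrA ck_P_mul eqxx. Qed.

Lemma S_path_cons l (p : gpath E l.+1) : Sp p = S (phead p) * Sp (pbehead p).
Proof.
rewrite [in LHS]/S_path pedges_cons big_cons S_pathE mulrA.
by rewrite ck_edge_range.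
Qed.

Lemma S_path_rcons l (p : gpath E l.+1) : Sp p = Sp (pbelast p) * S (plast p).
Proof. by rewrite !S_pathE pedges_rcons -cats1 big_cat big_seq1 mulrA. Qed.

Lemma star_P v : star (P v) = P v.
Proof. by have [] := ck_proj ck v. Qed.

Lemma star_S_path_src l (p : gpath E l) :
  star (Sp p) * P (psource p) = star (Sp p).
Proof. by rewrite -{1}star_P -starM src_S_path. Qed.

(** Distinct first edges are orthogonal; equal ones cancel to the projection at
    their range, which [star (Sp (pbehead p))] absorbs because it is the source
    of [pbehead p]. *)
Lemma star_S_path_mul l (p q : gpath E l) :
  star (Sp p) * Sp q = if p == q then P (prange p) else 0.
Proof.
elim: l p q => [|l IHl] p q.
  by rewrite /S_path star_P ck_P_mul gpath0_eq prange0.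
rewrite (S_path_cons p) (S_path_cons q) starM gpath_cons_eq.
rewrite mulrA -[X in X * _]mulrA ck_star_mul.
case: eqP => [_|_] /=; last by rewrite mulr0 mul0r.
by rewrite -[rng _]/(psource (pbehead p)) star_S_path_src IHl prange_pbehead.
Qed.

Lemma star_S_path_edge l (p : gpath E l.+1) e :
  star (Sp p) * S e = if phead p == e then star (Sp (pbehead p)) else 0.
Proof.
rewrite S_path_cons starM -mulrA ck_star_mul.
case: eqP => _; last by rewrite mulr0.
by rewrite -[rng _]/(psource (pbehead p)) star_S_path_src.
Qed.

(** * Summands indexed by paths of the permutation graph *)

Context {k : nat} {tau : {perm gpath E k.+1}}.
Hypothesis tauP : endpoint_fixing tau.

Local Notation G := (perm_graph tau).
Local Notation lbl1 := (label1 tauP).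
Local Notation lbl2 := (label2 tauP).

Definition edge_term (mu : edge G) : A :=
  Sp (@pbelast E k (tau mu)) * S (edge_label2 mu) * star (Sp (@pbehead E k mu)).

Definition path_term l (B : gpath G l) : A :=
  Sp (tau_source B) * Sp (lbl2 B) * star (Sp (tau_range B)).

Lemma U_perm_edge e :
  U_perm P S tau * S e = \sum_(mu : edge G | edge_label1 mu == e) edge_term mu.
Proof.
rewrite /U_perm mulr_suml [RHS]big_mkcond; apply: eq_bigr => mu _.
rewrite -mulrA star_S_path_edge /edge_label1.
case: eqP => _; last by rewrite mulr0.
by rewrite S_path_rcons.
Qed.

Lemma label1_cons l (B : gpath G l.+1) (gamma : gpath E l.+1) :
  (lbl1 B == gamma) =
  (edge_label1 (phead B) == phead gamma) && (lbl1 (pbehead B) == pbehead gamma).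
Proof.
rewrite gpath_cons_eq.
have eq_head : phead (lbl1 B) = edge_label1 (phead B).
  by rewrite /phead {1}/pedges /= /thead tnth_map.
have -> : pbehead (lbl1 B) = lbl1 (pbehead B).
  apply: gpath_inj; last by rewrite /= behead_map.
  by rewrite {1}/psource /= eq_head.
by rewrite eq_head.
Qed.

Lemma pedges_label2 l (B : gpath G l) :
  pedges (lbl2 B) = map (@edge_label2 E k tau) (pedges B) :> seq (edge E).
Proof. by []. Qed.

Lemma psource_label2 l (B : gpath G l) :
  psource (lbl2 B) = prange (tau_source B).
Proof. by []. Qed.

(** With [alpha] the range of [mu] and [beta] the source of [B], the middle factor
    [S_alpha^* S_beta] is 0 unless [alpha = beta], and is then the projection at
    the range of [beta], where the second label of [B] starts. *)
Lemma edge_term_mul l (mu : edge G) (B : gpath G l) :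
  edge_term mu * path_term B =
  if psource B == rng mu then
    Sp (@pbelast E k (tau mu)) * (S (edge_label2 mu) * Sp (lbl2 B))
      * star (Sp (tau_range B))
  else 0.
Proof.
rewrite /edge_term /path_term !mulrA -[_ * _ * Sp (tau_source B)]mulrA.
rewrite star_S_path_mul eq_sym /tau_source.
case: eqP => [src_B|_]; last by rewrite mulr0 !mul0r.
rewrite -[_ * P _ * _]mulrA; congr (_ * _ * _).
by rewrite -src_B -psource_label2 src_S_path.
Qed.

(** The first edge [mu] of [B] ends, as a path of [E], where [tau mu] does,
    because [tau] fixes endpoints; so the second label of [phead B] ends where that of [pbehead B]
    starts, and the projection left by the middle factor disappears. *)
Lemma path_term_cons l (B : gpath G l.+1) :
  path_term B = edge_term (phead B) * path_term (pbehead B).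
Proof.
rewrite edge_term_mul eqxx /path_term.
have -> : tau_range B = tau_range (pbehead B).
  by rewrite /tau_range prange_pbehead.
have -> : tau_source B = pbelast (tau (phead B)).
  exact: (psource_phead B).
congr (_ * _ * _).
rewrite {1}/S_path pedges_label2 (pedges_cons B) /= big_cons S_pathE.
rewrite psource_label2 /tau_source mulrA.
have -> : prange (psource (pbehead B)) = rng (edge_label2 (phead B)).
  have [_ tau_rng] := endpoint_fixingE (phead B : gpath E k.+1) tauP.
  by rewrite /edge_label2 -prange_plast tau_rng -prange_pbehead.
by rewrite ck_edge_range.
Qed.

(** Expanding the product gives all pairs [(mu, B)] with the right first labels,
    and only the composable ones contribute. *)
Lemma sum_edge_path_term l (gamma : gpath E l.+1) :
  (\sum_(mu : edge G | edge_label1 mu == phead gamma) edge_term mu)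
    * (\sum_(B : gpath G l | lbl1 B == pbehead gamma) path_term B) =
  \sum_(B : gpath G l.+1 | lbl1 B == gamma) path_term B.
Proof.
pose Q (mu : edge G) (B : gpath G l) :=
  (edge_label1 mu == phead gamma) && (lbl1 B == pbehead gamma).
under [RHS]eq_bigl => B do rewrite label1_cons -/(Q _ _).
under [RHS]eq_bigr => B _ do rewrite path_term_cons.
rewrite (@sum_gpath_cons G A l Q (fun mu B => edge_term mu * path_term B)).
rewrite mulr_suml big_mkcond; apply: eq_bigr => mu _.
rewrite /Q; case: eqP => _ /=; last by rewrite big_pred0 // => B; rewrite andbF.
rewrite mulr_sumr [LHS]big_mkcond [RHS]big_mkcond; apply: eq_bigr => B _.
rewrite edge_term_mul; case: (psource B == rng mu) => //=.
by case: ifP.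
Qed.

(** The summand of a path of length 0, that is of a vertex [alpha] of the
    permutation graph, is the projection [S_alpha S_alpha^*].  These are
    orthogonal, and the one that [edge_term mu] does not annihilate, at the
    range of [mu], is its initial projection. *)
Lemma edge_term_unit (v : gpath E 0) (mu : edge G) :
  psource v = rng (edge_label1 mu) ->
  edge_term mu * (\sum_(B : gpath G 0 | lbl1 B == v) path_term B) =
  edge_term mu.
Proof.
move=> src_v; have [B src_B] := gpath0_ex (rng mu).
rewrite (bigD1 B) /=; last first.
  by rewrite gpath0_eq src_v {1}/psource /= /tau_source src_B.
rewrite mulrDr mulr_sumr [X in _ + X]big1 ?addr0; last first.
  move=> C /andP[_]; rewrite gpath0_eq src_B => /negPf neq_C.
  by rewrite edge_term_mul neq_C.
rewrite edge_term_mul src_B eqxx /tau_range prange0 src_B /edge_term.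
congr (_ * _ * _).
rewrite [Sp (lbl2 B)]/S_path psource_label2 /tau_source src_B.
have [_ tau_rng] := endpoint_fixingE (mu : gpath E k.+1) tauP.
rewrite [prange _]prange_pbehead -tau_rng prange_plast.
exact: ck_edge_range.
Qed.

End CuntzKrieger.

Theorem proposition3p8 (R : realType) (E : digraph)
    (CE : cstarAlgType R) (P : vertex E -> CE) (S : edge E -> CE)
    (CE_univ : is_graph_algebra P S)
    (E_no_sinks : no_sinks E) (E_no_sources : no_sources E)
    (E_exit : every_cycle_has_exit E)
    (k : nat) (tau : {perm gpath E k.+1}) (tauP : endpoint_fixing tau)
    (lambda : CE -> CE) (lambdaP : is_lambda P S tau lambda)
    (l : nat) (l_ge1 : (1 <= l)%N) (gamma : gpath E l) :
  lambda (S_path P S gamma) =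
    \sum_(A in label1 tauP (l := l) @^-1: [set gamma]%SET)
      S_path P S (tau_source A) * S_path P S (label2 tauP A)
        * star (S_path P S (tau_range A)).
Proof.
have ck := graph_algebra_ck CE_univ.
have lambdaM := star_homM (lambda_hom lambdaP).
rewrite (eq_bigl (fun A => label1 tauP A == gamma)); last first.
  by move=> A; rewrite !inE.
rewrite -/(path_term tauP _).
case: l l_ge1 gamma => // l _; elim: l => [|l IHl] gamma.
  have -> : S_path P S gamma = S (phead gamma).
    by rewrite (S_path_cons ck) -[RHS](ck_edge_range ck).
  rewrite (lambda_edge lambdaP) (U_perm_edge ck) -(sum_edge_path_term ck).
  rewrite mulr_suml; apply: eq_bigr => mu /eqP lbl_mu.
  by rewrite (edge_term_unit ck) // lbl_mu.
rewrite (S_path_cons ck) lambdaM IHl (lambda_edge lambdaP) (U_perm_edge ck).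
exact: (sum_edge_path_term ck).
Qed.
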